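(* Let $X$ be a Banach space and let $T:X\to X$ be a bounded linear operator. If $T$ satisfies the Distributional Chaos Criterion, then $T$ admits a distributionally irregular vector.
   Context: For $A\subset\mathbb{N}$, the upper density is $\overline{\operatorname{dens}}(A)=\limsup_{n}\frac{\operatorname{card}(A\cap[1,n])}{n}$. The operator $T$ satisfies the Distributional Chaos Criterion (DCC) if there exist sequences $(x_m)_m$ and $(y_m)_m$ in $X\setminus\{0\}$ with $y_m\in\overline{\operatorname{span}\{x_k : k\in\mathbb{N}\}}$ for every $m$ such that (a) $\lim_{n\to\infty}T^nx_k=0$ for every $k\in\mathbb{N}$, and (b) there is a sequence of positive integers $(N_m)_m$ increasing to $\infty$ such that $$\lim_{m\to\infty}\frac{1}{N_m}\operatorname{card}\{0\le i<N_m : \|T^iy_m\|\ge m\|y_m\|\}=1.$$ A vector $x\in X$ is distributionally irregular for $T$ if there are increasing sequences of positive integers $A=(n_k)_k$ and $B=(m_k)_k$ such that $\overline{\operatorname{dens}}(A)=\overline{\operatorname{dens}}(B)=1$ (regarding $A,B$ as subsets of $\mathbb{N}$), $\lim_k\|T^{n_k}x\|=0$ and $\lim_k\|T^{m_k}x\|=\infty$. *)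

(* Defs.v *)
From HB Require Import structures.
From mathcomp Require Import all_boot all_order all_algebra.
From mathcomp Require Import all_classical all_reals.
From mathcomp Require Import ereal topology normedtype sequences.
From mathcomp Require Export complex.

Set Implicit Arguments.
Unset Strict Implicit.
Unset Printing Implicit Defensive.

Import Order.TTheory GRing.Theory Num.Theory.
Import numFieldNormedType.Exports.

Local Open Scope classical_set_scope.
Local Open Scope ring_scope.

Definition card_upto (A : set nat) (n : nat) : nat :=
  count (fun i => i \in A) (iota 1 n).

(* The term n = 0 is 0 / 0 = 0, which does not affect the limsup. *)
Definition upper_density (R : realType) (A : set nat) : \bar R :=
  limn_esup (fun n : nat => ((card_upto A n)%:R / n%:R : R)%:E).

Definition linear_span (K : numFieldType) (X : lmodType K) (A : set X) :
    set X :=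
  [set z | exists (n : nat) (c : 'I_n -> K) (v : 'I_n -> X),
      (forall i, A (v i)) /\ z = \sum_(i < n) c i *: v i].

(* The norm of X takes its values in the scalar field K, which is meant to be
   R or R[i]; densities and frequencies are computed in R. The strict
   positivity of N and its (weak) monotonicity together with divergence
   render "positive integers increasing to infinity". *)
Definition distributional_chaos_criterion (R : realType) (K : numFieldType)
    (X : normedModType K) (T : X -> X) : Prop :=
  exists (x y : nat -> X),
    [/\ forall m, x m != 0,
        forall m, y m != 0,
        forall m, closure (linear_span (range x)) (y m),
        forall k, iter n T (x k) @[n --> \oo] --> (0 : X) &
        exists N : nat -> nat,
          [/\ forall m, (0 < N m)%N,
              {homo N : m n / (m <= n)%N},
              N m @[m --> \oo] --> \oo &
              (#|[pred i : 'I_(N m) | m%:R * `|y m| <= `|iter i T (y m)|]|%:R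
                 / (N m)%:R : R) @[m --> \oo] --> (1 : R)]].

Definition distributionally_irregular (R : realType) (K : numFieldType)
    (X : normedModType K) (T : X -> X) (x : X) : Prop :=
  exists (a b : nat -> nat),
    [/\ (forall k, (0 < a k)%N) /\ {homo a : k l / (k < l)%N},
        (forall k, (0 < b k)%N) /\ {homo b : k l / (k < l)%N},
        upper_density R (range a) = 1%E /\ upper_density R (range b) = 1%E,
        `|iter (a k) T x| @[k --> \oo] --> (0 : K) &
        `|iter (b k) T x| @[k --> \oo] --> +oo].

(* Main.v *)
Require Import Defs.
From mathcomp Require Import all_boot all_order all_algebra.
From mathcomp Require Import all_classical all_reals.
From mathcomp Require Import ereal topology normedtype sequences.
From mathcomp Require Import zify.
Import Order.TTheory GRing.Theory Num.Theory.
Import numFieldNormedType.Exports.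

Set Implicit Arguments.
Unset Strict Implicit.
Unset Printing Implicit Defensive.

Local Open Scope classical_set_scope.
Local Open Scope ring_scope.

(** Let D be the linear subspace of the vectors whose orbit tends to 0. The
irregular vector is found in the closure of D by a category argument.

For each j, consider the vectors x for which there is some n >= j such that
T^i x is small, of norm less than 1/(j+1), for all i < n but a proportion at
most 1/j; and likewise those for which T^i x is large, of norm more than j, for
all i < n but a proportion at most 1/j. Both conditions on x involve finitely
many iterates and strict inequalities, so they are open ([near_rare]). Both
can be met in D by arbitrarily small perturbations of any z in D:
- z itself meets the first one, since its orbit tends to 0
  ([null_orbit_often_small]);
- for the second one, add to z a small multiple c y_m of a vector y_m of the
  criterion, with m large. The orbit of z is bounded and that of c y_m has norm
  at least m |c y_m| most of the time up to N_m, so that the sum is large most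
  of the time. As only the iterates up to N_m matter, y_m can be replaced by a
  nearby element of the span of the x_k, which lies in D
  ([dcc_often_large]).

A nested sequence of balls centred in D ([sequential_baire]) then gives one
vector x which meets all these conditions at once; it is a limit of points of
D, and need not lie in D.

It remains to extract from these scattered prefixes one set of times A along
which the orbit tends to 0, and one along which it tends to infinity. This is a
diagonal construction on sets of integers ([rare_diagonal]): A follows the j-th
requirement from a time N_j on, where each N_(j+1) is so large with respect to
N_j that A still fills almost all of [0, N_(j+1)), which makes its upper
density equal to 1 ([upper_density_eq1]).

The argument makes sense over any archimedean field of scalars, which covers
the real and the complex cases at once. *)

(** * Archimedean fields of scalars *)

Definition archimedean (K : numFieldType) : Prop :=
  forall e : K, 0 < e -> exists k, k.+1%:R^-1 < e.

Lemma archimedean_realType (R : realType) : archimedean R.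
Proof.
move=> e e0; exists (Num.truncn e^-1).
by rewrite invf_plt ?posrE ?ltr0n // truncnS_gt.
Qed.

(** * Sets of integers that fill most of some long prefixes *)

(** The proportion 1/j is encoded by a multiplication, so as to stay in nat. The
bound j <= n makes the witnesses n tend to infinity with j. *)
Definition rare (j : nat) (B : pred nat) (n : nat) : bool :=
  ((j <= n) && (j * count B (iota 0 n) <= n))%N.

Lemma rare_sub (j k n : nat) (B C : pred nat) :
  (j <= k)%N -> {subset B <= C} -> rare k C n -> rare j B n.
Proof.
move=> jk BC /andP[kn Cn]; rewrite /rare (leq_trans jk kn) /=.
by apply: leq_trans Cn; apply: leq_mul => //; apply: sub_count.
Qed.

Lemma count_ltn_iota (m n l : nat) :
  (count (fun i => i < l) (iota m n) <= l)%N.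
Proof.
rewrite -size_filter -[leqRHS](size_iota 0 l); apply: uniq_leq_size.
  by rewrite filter_uniq ?iota_uniq.
by move=> i; rewrite mem_filter mem_iota => /andP[il _]; rewrite mem_iota.
Qed.

(** The set A obeys S_1, ..., S_(j+1) from the time N_j on. Hence on
[0, N_(j+1)) its complement is made of at most N_j early points and of few
points outside S_(j+1). *)
Lemma rare_diagonal (S : nat -> pred nat) :
  (forall j k, (j <= k)%N -> {subset S k <= S j}) ->
  (forall j, exists n, rare j (predC (S j)) n) ->
  exists A : pred nat, [/\ ~~ A 0%N,
    forall j, exists n, rare j (predC A) n &
    forall j, exists l, forall i, (l <= i)%N -> A i -> S j i].
Proof.
move=> Sdec /choice[n_ rare_n].
(* Starting from 1 lets the points below N_j absorb the point 0. *)
pose N := fix N j := if j is j'.+1 then n_ (j * (N j').+1)%N else 1%N.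
have NS j : (j.+1 * (N j).+1 <= N j.+1)%N.
  by case/andP: (rare_n (j.+1 * (N j).+1)%N).
have N_gt0 j : (0 < N j)%N by case: j => [//|j]; apply: leq_trans (NS j).
have Nmono : {homo N : i j / (i <= j)%N}.
  apply: homo_leq => //; first exact: leq_trans.
  move=> j; apply: leq_trans (NS j); lia.
pose A i := (0 < i)%N && `[< forall j, (N j <= i)%N -> S j.+1 i >].
have AS j i : (N j <= i < N j.+1)%N -> S j.+1 i -> A i.
  move=> /andP[ji ij] Si; rewrite /A (leq_trans (N_gt0 j) ji).
  apply/asboolP => k ki.
  have kj : (k <= j)%N.
    rewrite leqNgt; apply/negP => /Nmono.
    by rewrite leqNgt (leq_ltn_trans ki ij).
  exact: (Sdec k.+1 j.+1 kj i Si).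
exists A; split => //; last first.
  move=> j; exists (N j) => i ji /andP[_ /asboolP /(_ j ji)].
  exact: (Sdec j j.+1 (leqnSn j) i).
(* Early points and points outside S_(k+1) each have proportion at most
   1/(k+1) in the prefix: hence the choice k = 2j. *)
move=> j; pose k := j.*2; exists (N k.+1).
have [leN rareN] := andP (rare_n (k.+1 * (N k).+1)%N).
rewrite -/(N k.+1) in leN rareN.
have : (count (predC A) (iota 0 (N k.+1)) <=
   N k + count (predC (S (k.+1 * (N k).+1)%N)) (iota 0 (N k.+1)))%N.
  apply: leq_trans (leq_add (count_ltn_iota 0 (N k.+1) (N k)) (leqnn _)).
  rewrite -count_predUI; apply: leq_trans (leq_addr _ _).
  rewrite -!size_filter; apply: uniq_leq_size.
    by rewrite filter_uniq ?iota_uniq.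
  move=> i; rewrite !mem_filter mem_iota add0n => /andP[/= nAi iN].
  rewrite iN andbT.
  case: ltnP => //= ki; apply: contra nAi => Si; apply: (AS k).
    by rewrite ki.
  by apply: Sdec Si; lia.
rewrite /rare.
move: (count _ _) (count _ _) rareN leN => c d rareN leN cd.
apply/andP; split; first by lia.
have k1 : (k.+1 * d <= N k.+1)%N.
  by apply: leq_trans rareN; rewrite mulnAC leq_pmulr.
have k2 : (k.+1 * N k <= N k.+1)%N by apply: leq_trans leN; rewrite leq_mul.
have : (k.+1 * c <= k.+1 * (N k + d))%N by rewrite leq_mul.
rewrite mulnDr => kc; have {kc k1 k2} : (k.+1 * c <= N k.+1 + N k.+1)%N by lia.
rewrite [in X in (X <= _)%N -> _]/k mulSn -muln2 mulnAC; lia.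
Qed.

Lemma rare_unbounded (A : pred nat) :
  (forall j, exists n, rare j (predC A) n) ->
  forall l, exists2 i, (l < i)%N & A i.
Proof.
move=> rareA l; apply/not_exists2P => noA.
have [n /andP[ln rn]] := rareA l.+3.
have : (count A (iota 0 n) <= l.+1)%N.
  apply: leq_trans (count_ltn_iota 0 n l.+1); apply: sub_count => i Ai.
  by rewrite ltnNge; apply/negP => li; have [] := noA i.
have := count_predC A (iota 0 n); rewrite size_iota.
move: (count _ _) (count _ _) rn => c d; nia.
Qed.

(** Excluding 0 is what makes all the terms of the enumeration positive. *)
Lemma pred_nat_enumeration (A : pred nat) :
  ~~ A 0%N -> (forall l, exists2 i, (l < i)%N & A i) ->
  exists a : nat -> nat, [/\ forall k, (0 < a k)%N, forall k, A (a k),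
    {homo a : k l / (k < l)%N} & range a = [set i | A i]].
Proof.
move=> A0 unbA.
have next l : exists i, (l < i)%N && A i.
  by have [i li Ai] := unbA l; exists i; rewrite li.
pose nx l := ex_minn (next l).
have nxP l : [/\ (l < nx l)%N, A (nx l) &
    forall i, (l < i)%N -> A i -> (nx l <= i)%N].
  rewrite /nx; case: ex_minnP => m /andP[lm Am] min_m; split=> // i li Ai.
  by apply: min_m; rewrite li.
pose a k := iter k.+1 nx 0%N.
have aS k : a k.+1 = nx (a k) by [].
have aA k : A (a k) by have [] := nxP (iter k nx 0%N).
have amono : {homo a : k l / (k < l)%N}.
  apply: homo_ltn; first exact: ltn_trans.
  by move=> k; rewrite aS; case: (nxP (a k)).
have a_ge k : (k < a k)%N.
  elim: k => [|k IHk]; first by have [] := nxP 0%N.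
  by apply: leq_ltn_trans IHk _; exact: amono.
exists a; split=> //; first by move=> k; apply: leq_ltn_trans (a_ge k).
apply/seteqP; split=> [_ [k _ <-]|i /= Ai]; first exact: aA.
apply: contrapT => noi.
have {}noi k : a k <> i by move=> aki; apply: noi; exists k.
suff /(_ i) : forall k, (a k < i)%N by rewrite ltnNge ltnW.
elim=> [|k IHk]; rewrite ltn_neqAle.
  apply/andP; split; first exact/eqP/noi.
  have [_ _] := nxP 0%N; apply=> //.
  by rewrite lt0n; apply: contra A0 => /eqP <-.
apply/andP; split; first exact/eqP/noi.
by have [_ _] := nxP (a k); apply.
Qed.

(** All the suprema of the tails of the frequency are already equal to 1, since
the frequency never exceeds 1 and comes back arbitrarily close to it. *)
Lemma upper_density_eq1 (R : realType) (A : set nat) :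
  (forall j, exists n, rare j (fun i => i \notin A) n) ->
  upper_density R A = 1%E.
Proof.
move=> rareA; rewrite /upper_density limn_esup_lim.
set u := fun n : nat => _.
suff -> : esups u = cst 1%E by rewrite lim_cst.
apply/funext => l /=; apply/eqP; rewrite eq_le; apply/andP; split.
  apply: ge_ereal_sup => _ [n _ <-]; rewrite /u lee_fin.
  have [->|n0] := posnP n; first by rewrite invr0 mulr0.
  rewrite ler_pdivrMr ?ltr0n // mul1r ler_nat /card_upto.
  by rewrite (leq_trans (count_size _ _)) ?size_iota.
apply/lee_addgt0Pr => e e0.
have [k ke] := archimedean_realType e0.
pose j := (maxn l k.+1).*2.
have [n /andP[jn rn]] := rareA j.
rewrite -leeBlDr //; apply: le_trans (ereal_sup_ubound _); last first.
  exists n => //=; lia.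
rewrite /u -EFinB lee_fin.
have n0 : (0 < n)%N by lia.
have n0R : (0:R) < n%:R by rewrite ltr0n.
rewrite ler_pdivlMr // mulrBl mul1r.
rewrite lerBlDr -lerBlDl.
apply: (@le_trans _ _ (k.+1%:R^-1 * n%:R)); last by rewrite ler_pM2r // ltW.
rewrite ler_pdivlMl ?ltr0n //.
(* Passing from [0, n) to [1, n] costs at most one point, which is a
   proportion at most 1/j since j <= n: hence the factor 2 in j. *)
have hc : (k.+1 * n <= n + k.+1 * card_upto A n)%N.
  have : (count (fun i => i \notin A) (iota 1 n) <=
      (count (fun i => i \notin A) (iota 0 n)).+1)%N.
    rewrite (_ : iota 1 n = behead (iota 0 n.+1)) //.
    rewrite -[n.+1]addn1 iotaD /= add0n.
    case: n {jn rn n0 n0R} => [|n] //=.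
    rewrite count_cat /=; lia.
  have := count_predC (fun i => i \in A) (iota 1 n).
  rewrite size_iota -/(card_upto A n).
  rewrite [count (predC _) _](_ : _ =
    count (fun i => i \notin A) (iota 1 n)) //.
  rewrite /j in jn rn.
  move: (count _ _) (count _ _) (card_upto A n) rn => c d f; nia.
rewrite mulrBr lerBlDr -!natrM -natrD ler_nat; lia.
Qed.

Lemma exists_density1_sequence (R : realType) (S : nat -> pred nat) :
  (forall j k, (j <= k)%N -> {subset S k <= S j}) ->
  (forall j, exists n, rare j (predC (S j)) n) ->
  exists a : nat -> nat,
    [/\ forall k, (0 < a k)%N, {homo a : k l / (k < l)%N},
        upper_density R (range a) = 1%E &
        forall j, \forall k \near \oo, S j (a k)].
Proof.
move=> Sdec rareS; have [A [A0 rareA AS]] := rare_diagonal Sdec rareS.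
have [a [a0 aA amono rangea]] := pred_nat_enumeration A0 (rare_unbounded rareA).
exists a; split=> //.
  apply: upper_density_eq1 => j; have [n rn] := rareA j; exists n.
  by apply: rare_sub rn => // i; rewrite !unfold_in /= rangea => /asboolP /negP.
move=> j; have [l lP] := AS j; exists l => // k /= lk; apply: lP => //.
apply: leq_trans lk _; elim: k => // k IHk.
by apply: leq_ltn_trans IHk _; exact: amono.
Qed.

Lemma rare_of_frequency (R : realType) (N : nat -> nat) (G : nat -> pred nat)
    (j : nat) :
  (forall m, 0 < N m)%N -> N m @[m --> \oo] --> \oo ->
  (#|[pred i : 'I_(N m) | G m i]|%:R / (N m)%:R : R) @[m --> \oo] --> (1 : R) ->
  \forall m \near \oo, rare j (predC (G m)) (N m).
Proof.
move=> N0 Noo freq.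
have j0 : 0 < j.+1%:R^-1 :> R by rewrite invr_gt0 ltr0n.
have jN : \forall m \near \oo, (j <= N m)%N by move/cvgnyPge : Noo; exact.
have /cvgrPdist_lt/(_ _ j0) freq1 := freq.
near=> m.
rewrite /rare; apply/andP; split; first by near: m.
have cardE : #|[pred i : 'I_(N m) | G m i]| = count (G m) (iota 0 (N m)).
  by rewrite -val_enum_ord count_map cardE -size_filter enumT.
have : `|1 - #|[pred i : 'I_(N m) | G m i]|%:R / (N m)%:R| < j.+1%:R^-1 :> R.
  by near: m.
have NR0 : (0 : R) < (N m)%:R by rewrite ltr0n.
rewrite cardE => /ltr_normlW.
rewrite -(ltr_pM2r NR0) mulrBl mul1r divfK ?gt_eqF // ltr_pdivlMl ?ltr0n //.
have := count_predC (G m) (iota 0 (N m)); rewrite size_iota => /esym NE.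
rewrite {1}NE natrD addrAC subrr add0r -natrM ltr_nat; lia.
Unshelve. all: end_near.
Qed.

(** * Nested balls centred in a set *)

(** A Baire category argument in the closure of D, carried out by hand since D
itself is not complete: the centres of the nested balls stay in D, only their
limit leaves it. *)
Lemma sequential_baire (K : numFieldType) (X : completeNormedModType K)
    (D : set X) (P : nat -> set X) :
  archimedean K ->
  D !=set0 ->
  (forall j z e, D z -> 0 < e ->
     exists z', [/\ D z', `|z - z'| < e & nbhs z' (P j)]) ->
  \bigcap_j P j !=set0.
Proof.
move=> archiK [z0 Dz0] denseP.
pose inv (s : X * K) := D s.1 /\ 0 < s.2.
pose cb (s : X * K) := [set x | `|s.1 - x| <= s.2].
(* The invariant is a premise inside the existential, so that a step function
   defined on all pairs can be chosen. *)
have step (js : nat * (X * K)) : exists s', inv js.2 ->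
    [/\ inv s', cb s' `<=` cb js.2, cb s' `<=` P js.1 &
        forall x, cb s' x -> `|s'.1 - x| < js.1.+1%:R^-1].
  case: js => j [z r] /=.
  have [[/= Dz r0]|noinv] := pselect (inv (z, r)); last first.
    by exists (z, r) => /noinv.
  have r20 : 0 < r / 2 by rewrite divr_gt0.
  have [z' [Dz' zz' Pz']] := denseP j z (r / 2) Dz r20.
  have j0 : 0 < j.+1%:R^-1 :> K by rewrite invr_gt0 ltr0n.
  have : nbhs z' (P j `&` [set x | `|z' - x| < r / 2]
      `&` [set x | `|z' - x| < j.+1%:R^-1]).
    apply: filterI; last exact: (@cvgr_dist_lt _ _ _ _ _ id).
    by apply: filterI => //; exact: (@cvgr_dist_lt _ _ _ _ _ id).
  move=> /nbhs_normP[d /= d0 dsub].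
  have dsub' x : cb (z', d / 2) x ->
      [/\ P j x, `|z' - x| < r / 2 & `|z' - x| < j.+1%:R^-1].
    move=> /= xd; have [|[? ?] ?] := dsub x; last by split.
    rewrite /=; apply: le_lt_trans xd _.
    by rewrite ltr_pdivrMr // ltr_pMr // ltr1n.
  exists (z', d / 2) => _; split => //=.
  - by split => //=; rewrite divr_gt0.
  - move=> x /dsub'[_ xr _]; rewrite /cb /=.
    have -> : z - x = (z - z') + (z' - x) by rewrite addrA subrK.
    by rewrite (le_trans (ler_normD _ _)) // [leRHS]splitr lerD // ltW.
  - by move=> x /dsub'[].
  - by move=> x /dsub'[].
have [next nextP] := choice step.
pose s := fix s j := if j is j'.+1 then next (j', s j') else (z0, 1 : K).
have sinv j : inv (s j).
  by elim: j => [|j /(nextP (j, s j))[]//]; split => //=.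
have sP j := nextP (j, s j) (sinv j).
have scb j : cb (s j) (s j).1.
  by rewrite /cb /= subrr normr0 ltW //; case: (sinv j).
have sdec i j : (i <= j)%N -> cb (s j) `<=` cb (s i).
  move=> /subnK <-; elim: (j - i)%N => [//|k IHk].
  by apply: subset_trans IHk; case: (sP (k + i)%N).
pose z j := (s j).1.
have zcb i j : (i <= j)%N -> cb (s i) (z j).
  by move=> /sdec; apply; exact: scb.
have : cvg (z @ \oo).
  apply/cauchy_cvgP/cauchy_exP => e e0.
  have [k ke] := archiK e e0.
  exists (z k.+1); exists k.+1 => // i /= ki.
  rewrite -ball_normE /=; apply: lt_trans ke.
  by have [_ _ _] := sP k; apply; exact: (zcb k.+1 i ki).
move=> /cvg_ex[l zl].
suff lcb j : cb (s j) l.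
  by exists l => j _; have [_ _ sub _] := sP j; apply: sub; exact: (lcb j.+1).
have [_ sj0] := sinv j.
rewrite /cb /= real_leNgt ?normr_real ?gtr0_real //; apply/negP => lt_s.
rewrite -subr_gt0 in lt_s.
have /cvgrPdist_lt/(_ _ lt_s)[i _ near_l] := zl.
have ji : (i <= maxn i j)%N by rewrite leq_maxl.
have := near_l _ ji; rewrite /= le_gtF // lerBlDl.
have -> : (s j).1 - l = ((s j).1 - z (maxn i j)) + (z (maxn i j) - l).
  by rewrite addrA subrK.
apply: le_trans (ler_normD _ _) _; rewrite [`|l - _|]distrC lerD2r.
exact: (zcb _ _ (leq_maxr i j)).
Qed.

(** * Openness of conditions on finitely many iterates *)

(** The times i < n at which f_i z avoids B are finitely many, so f_i x still
avoids B at all of them when x is close to z. *)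
Lemma near_rare (X Y : topologicalType) (f : nat -> X -> Y) (B : pred Y)
    (j n : nat) (z : X) :
  (forall i, continuous (f i)) -> open [set v | ~~ B v] ->
  rare j (fun i => B (f i z)) n ->
  \forall x \near z, rare j (fun i => B (f i x)) n.
Proof.
move=> f_cont openB /andP[jn Bz].
have : \forall x \near z, forall i : 'I_n, ~~ B (f i z) -> ~~ B (f i x).
  apply: filter_forall => i.
  have [Bfz|nBfz] := boolP (B (f i z)); first by near=> x.
  have : \forall x \near z, ~~ B (f i x).
    by have := f_cont i z _ (open_nbhs_nbhs (conj openB nBfz)).
  by apply: filterS.
apply: filterS => x Bx; rewrite /rare jn /=; apply: leq_trans Bz.
rewrite leq_mul // -!size_filter; apply: uniq_leq_size.
  by rewrite filter_uniq ?iota_uniq.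
move=> i; rewrite !mem_filter mem_iota add0n /= => /andP[Bi i_n].
rewrite i_n andbT.
by apply: contraLR Bi; exact: (Bx (Ordinal i_n)).
Unshelve. all: end_near.
Qed.

Lemma open_norm_gt (K : numFieldType) (X : normedModType K) (r : K) :
  r \is Num.real -> open [set v : X | ~~ (`|v| <= r)].
Proof.
move=> r_real; rewrite openE => v /=; rewrite -real_ltNge ?normr_real // => rv.
rewrite /interior; apply/nbhs_normP; exists (`|v| - r) => /=.
  by rewrite subr_gt0.
move=> x /= vx; rewrite -real_ltNge ?normr_real //.
rewrite -(ltrD2l (`|v| - r)) subrK.
apply: le_lt_trans (_ : `|v - x| + `|x| < _); last by rewrite ltrD2r.
by rewrite -{1}(subrK x v) ler_normD.
Qed.

Lemma open_norm_lt (K : numFieldType) (X : normedModType K) (r : K) :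
  r \is Num.real -> open [set v : X | ~~ (r <= `|v|)].
Proof.
move=> r_real.
have -> : [set v : X | ~~ (r <= `|v|)] = ball 0 r.
  apply/seteqP; split=> v /=;
    by rewrite -ball_normE /= sub0r normrN -real_ltNge ?normr_real.
have [r0|r0] := real_ltP (real0 K) r_real; first exact: ball_open.
suff -> : ball (0 : X) r = set0 by exact: open0.
apply/seteqP; split=> v //; rewrite -ball_normE /= => /lt_le_trans/(_ r0).
by rewrite normr_lt0.
Qed.

(** * Vectors with null orbit *)

Section Orbit.
Variables (K : numFieldType) (X : normedModType K) (T : {linear X -> X}).

Lemma iter_linear n : linear (iter n T).
Proof. by elim: n => [//|n IHn] a x y; rewrite !iterS IHn linearP. Qed.

Lemma iter_continuous n : continuous T -> continuous (iter n T).
Proof.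
move=> T_cont; elim: n => [|n IHn] x; first exact: cvg_id.
exact: (@continuous_comp _ _ _ (iter n T) T x (IHn x) (T_cont _)).
Qed.

Definition null_orbits : set X := [set z | iter n T z @[n --> \oo] --> (0 : X)].

Lemma null_orbits_lin a x y :
  null_orbits x -> null_orbits y -> null_orbits (a *: x + y).
Proof.
move=> x0 y0; rewrite /null_orbits /=.
rewrite -[X in _ --> X](addr0 (0 : X)) -[X in _ --> X + _](scaler0 _ a).
under eq_fun do rewrite iter_linear.
by apply: cvgD => //; apply: cvgZr.
Qed.

Lemma null_orbits0 : null_orbits 0.
Proof.
have iter0 n : iter n T 0 = 0 by elim: n => //= n ->; rewrite linear0.
rewrite /null_orbits /=; under eq_fun do rewrite iter0.
exact: cvg_cst.
Qed.

Lemma span_null_orbits (x : nat -> X) :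
  (forall k, null_orbits (x k)) -> linear_span (range x) `<=` null_orbits.
Proof.
move=> x0 _ [n [c [v [xv ->]]]].
elim/big_ind: _ => [|u w u0 w0|i _].
- exact: null_orbits0.
- by rewrite -[u]scale1r; exact: null_orbits_lin.
- rewrite -[_ *: _]addr0; apply: null_orbits_lin null_orbits0.
  by have [k _ <-] := xv i.
Qed.

Lemma null_orbit_bounded z : null_orbits z ->
  exists2 C : K, 0 <= C & forall n, `|iter n T z| <= C.
Proof.
move=> /cvgr0Pnorm_lt/(_ _ ltr01)[l _ zl].
have C0 : 0 <= \sum_(i < l) `|iter i T z| by rewrite sumr_ge0.
exists (1 + \sum_(i < l) `|iter i T z|); first by rewrite addr_ge0.
move=> n; have [ln|nl] := leqP l n.
  by rewrite ler_wpDr // ltW //; exact: zl.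
rewrite ler_wpDl // (bigD1 (Ordinal nl)) //= ler_wpDr // sumr_ge0 //.
Qed.

End Orbit.

Lemma bounded_continuous (K : numFieldType) (X : normedModType K)
    (T : {linear X -> X}) (M : K) :
  (forall x, `|T x| <= M * `|x|) -> continuous T.
Proof.
move=> TM; apply/linear_bounded_continuous/linear_boundedP.
exists `|M|; split; first exact: normr_real.
move=> r Mr x; apply: le_trans (TM x) _.
have Mx0 : 0 <= M * `|x| by apply: le_trans (TM x).
by rewrite -(ger0_norm Mx0) normrM normr_id ler_wpM2r // ltW.
Qed.

(** * Orbits that are often small and often large *)

(** Only the first l iterates may be large, which is a proportion at most 1/j of a
prefix of length at least j * l. *)
Lemma null_orbit_often_small (K : numFieldType) (X : normedModType K)
    (T : {linear X -> X}) (z : X) (j : nat) (e : K) :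
  null_orbits T z -> 0 < e -> exists n, rare j (fun i => e <= `|iter i T z|) n.
Proof.
move=> /cvgr0Pnorm_lt/[apply] -[l _ zl].
exists (j * l.+1)%N; rewrite /rare leq_pmulr //= leq_mul // ltnW // ltnS.
apply: leq_trans (count_ltn_iota 0 (j * l.+1) l); apply: sub_count => i /= ei.
by rewrite ltnNge; apply: contraL ei => /zl /= ze; rewrite lt_geF.
Qed.

(** The vector z' is z + c v, where c = e / (2 |y_m|) and v is an element of the
span of the x_k close to y_m. If C bounds the orbit of z, then z' is
large as soon as T^i (c v) has norm more than C + j. *)
Lemma dcc_often_large (R : realType) (K : numFieldType) (X : normedModType K)
    (T : {linear X -> X}) (z : X) (j : nat) (e : K) :
  archimedean K ->
  continuous T -> distributional_chaos_criterion R T ->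
  null_orbits T z -> 0 < e ->
  exists z', [/\ null_orbits T z', `|z - z'| < e &
    exists n, rare j (fun i => `|iter i T z'| <= j%:R) n].
Proof.
move=> archiK T_cont [x [y [_ y0 y_span x0 [N [N0 _ Noo freq]]]]] z0 e0.
have [C C0 zC] := null_orbit_bounded z0.
have Cj0 : 0 < C + j%:R + 1 by rewrite ltr_wpDl // addr_ge0.
have e20 : 0 < e / 2 by rewrite divr_gt0.
have [k ke] := archiK _ (divr_gt0 e20 Cj0).
have kbig m : (k < m)%N -> C + j%:R < m%:R * (e / 2).
  move=> km; move: ke; rewrite ltr_pdivlMr // ltr_pdivrMl ?ltr0n // => ke.
  apply: (@lt_trans _ _ (C + j%:R + 1)); first by rewrite ltrDl.
  by apply: lt_le_trans ke _; rewrite ler_pM2r // ler_nat.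
(* Times where y_m is amplified by m are times where c y_m has norm at least
   m e / 2, which exceeds C + j once m > k. *)
have [m [km rare_m]] : exists m, (k < m)%N /\
    rare j (predC (fun i => m%:R * `|y m| <= `|iter i T (y m)|)) (N m).
  have [l _ lP] := @rare_of_frequency R N
    (fun m i => m%:R * `|y m| <= `|iter i T (y m)|) j N0 Noo freq.
  exists (maxn l k.+1); split; first by rewrite leq_maxr.
  by apply: lP; rewrite /= leq_maxl.
have ym0 : 0 < `|y m| by rewrite normr_gt0.
pose c := e / 2 / `|y m|.
have c0 : 0 < c by rewrite divr_gt0.
pose f i v := iter i T (c *: v).
have f_cont i : continuous (f i).
  move=> v; apply: (@continuous_comp _ _ _ ( *:%R c) (iter i T)).
    exact: scaler_continuous.
  exact: iter_continuous.
have rare_f : rare j (fun i => `|f i (y m)| <= C + j%:R) (N m).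
  apply: rare_sub rare_m => // i; rewrite !unfold_in /= => fi.
  apply/negP => /(ler_wpM2l (ltW c0)); apply/negP.
  rewrite -real_ltNge ?realM ?ger0_real ?mulr_ge0 // ?ltW //.
  have -> : c * `|iter i T (y m)| = `|f i (y m)|.
    rewrite /f; have := iter_linear T i c (y m) 0; rewrite addr0.
    have -> : iter i T 0 = 0 by elim: i {fi} => //= i ->; rewrite linear0.
    by rewrite addr0 => ->; rewrite normrZ gtr0_norm.
  apply: le_lt_trans fi _.
  rewrite [ltRHS]mulrCA /c divfK ?gt_eqF //; exact: kbig.
have Cj_real : C + j%:R \is Num.real by rewrite ger0_real // addr_ge0.
have near_y := near_rare f_cont (@open_norm_gt _ X _ Cj_real) rare_f.
have near_e : \forall v \near y m, `|c *: v| < e.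
  apply/nbhs_normP; exists (`|y m|) => //= v yv.
  rewrite normrZ gtr0_norm //.
  have : `|v| < `|y m| + `|y m|.
    rewrite -ltrBlDr; apply: le_lt_trans yv; rewrite lerBlDr.
    by rewrite -{1}(subrK (y m) v) distrC ler_normD.
  rewrite -(ltr_pM2l c0) mulrDr /c !divfK ?gt_eqF // -splitr; exact.
have [v [v_span [rare_v ve]]] := y_span m _ (filterI near_y near_e).
have v0 : null_orbits T v by exact: span_null_orbits v_span.
exists (c *: v + z); split.
- exact: null_orbits_lin.
- by rewrite [_ *: _ + _]addrC opprD addNKr normrN.
- exists (N m); apply: rare_sub rare_v => // i; rewrite !unfold_in /= => le_j.
  have -> : f i v = iter i T (c *: v + z) - iter i T z.
    have := iter_linear T i 1 (c *: v) z; rewrite !scale1r => ->.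
    by rewrite addrK.
  by rewrite (le_trans (ler_normB _ _)) // addrC lerD.
Qed.

(** The two countable families of conditions are interleaved, by the parity of
the index. *)
Lemma exists_often_small_large (R : realType) (K : numFieldType)
    (X : completeNormedModType K) (T : {linear X -> X}) :
  archimedean K ->
  continuous T -> distributional_chaos_criterion R T ->
  exists x : X,
    (forall j, exists n, rare j (fun i => j.+1%:R^-1 <= `|iter i T x|) n) /\
    (forall j, exists n, rare j (fun i => `|iter i T x| <= j%:R) n).
Proof.
move=> archiK T_cont dcc.
pose small j := [set x : X |
  exists n, rare j (fun i => j.+1%:R^-1 <= `|iter i T x|) n].
pose large j := [set x : X |
  exists n, rare j (fun i => `|iter i T x| <= j%:R) n].
pose P k := if odd k then large k./2 else small k./2.
have iter_cont i := @iter_continuous K X T i T_cont.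
have nbhs_small j z : small j z -> nbhs z (small j).
  move=> [n zn].
  have j_real : j.+1%:R^-1 \is @Num.real K by rewrite realV realn.
  have := near_rare iter_cont (@open_norm_lt _ X _ j_real) zn.
  by apply: filterS => x; exists n.
have nbhs_large j z : large j z -> nbhs z (large j).
  move=> [n zn].
  have := near_rare iter_cont (@open_norm_gt _ X _ (realn K j)) zn.
  by apply: filterS => x; exists n.
have [|k z e z0 e0|x Px] := @sequential_baire K X (null_orbits T) P archiK.
- by exists 0; exact: null_orbits0.
- rewrite /P; case: ifP => _.
    have [z' [z'0 zz' z'_large]] :=
      dcc_often_large k./2 archiK T_cont dcc z0 e0.
    by exists z'; split => //; exact: nbhs_large.
  exists z; split => //; first by rewrite subrr normr0.
  by apply: nbhs_small; apply: null_orbit_often_small; rewrite ?invr_gt0 ?ltr0n.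
- exists x; split => j.
    by have := Px j.*2 I; rewrite /P odd_double doubleK.
  by have := Px j.*2.+1 I; rewrite /P /= odd_double /= uphalf_double.
Qed.

Lemma dcc_distributionally_irregular (R : realType) (K : numFieldType)
    (X : completeNormedModType K) (T : {linear X -> X}) (M : K) :
  archimedean K ->
  (forall x, `|T x| <= M * `|x|) -> distributional_chaos_criterion R T ->
  exists x : X, distributionally_irregular R T x.
Proof.
move=> archiK TM dcc.
have [x [x_small x_large]] :=
  exists_often_small_large archiK (bounded_continuous TM) dcc.
have [||a [a0 amono a1 aS]] := @exists_density1_sequence R
    (fun j i => ~~ (j.+1%:R^-1 <= `|iter i T x|)).
- move=> j k jk i; rewrite !unfold_in; apply: contra; apply: le_trans.
  by rewrite lef_pV2 ?posrE ?ltr0n // ler_nat.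
- move=> j; have [n rn] := x_small j; exists n; apply: rare_sub rn => // i.
  by rewrite !unfold_in /= negbK.
have [||b [b0 bmono b1 bS]] := @exists_density1_sequence R
    (fun j i => ~~ (`|iter i T x| <= j%:R)).
- move=> j k jk i; rewrite !unfold_in; apply: contra => /le_trans; apply.
  by rewrite ler_nat.
- move=> j; have [n rn] := x_large j; exists n; apply: rare_sub rn => // i.
  by rewrite !unfold_in /= negbK.
exists x, a, b; split => //.
- apply/cvgr0Pnorm_lt => e e0; have [k ke] := archiK e e0.
  apply: filterS (aS k) => i.
  rewrite -real_ltNge ?realV ?realn ?normr_real // => ai.
  by rewrite normr_id; apply: lt_trans ke.
- apply/cvgryPgtr => A A_real.
  have A10 : 0 < (`|A| + 1)^-1 by rewrite invr_gt0 ltr_wpDl.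
  have [k] := archiK _ A10; rewrite ltf_pV2 ?posrE ?ltr0n ?ltr_wpDl //.
  rewrite -natr1 ltrD2r => Ak.
  apply: filterS (bS k) => i; rewrite -real_ltNge ?realn ?normr_real //.
  by apply: lt_trans; apply: le_lt_trans Ak; exact: real_ler_norm.
Qed.

(* The scalar field is either that of the reals or that of the complexes. *)
Theorem proposition20 (R : realType) :
  (forall (X : completeNormedModType R) (T : {linear X -> X}),
     (exists M : R, forall x : X, `|T x| <= M * `|x|) ->
     distributional_chaos_criterion R T ->
     exists x : X, distributionally_irregular R T x) /\
  (forall (X : completeNormedModType R[i]) (T : {linear X -> X}),
     (exists M : R[i], forall x : X, `|T x| <= M * `|x|) ->
     distributional_chaos_criterion R T ->
     exists x : X, distributionally_irregular R T x).
Proof.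
split=> X T [M TM]; apply: dcc_distributionally_irregular TM.
  exact: archimedean_realType.
(* A positive element of R[i] is a positive real. *)
move=> [e i]; rewrite ltcE /= => /andP[/eqP -> /archimedean_realType[k ke]].
by exists k; rewrite -(rmorph_nat (real_complex R)) -fmorphV ltcR.
Qed.
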